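(* There exists a transitive, cofinitely sensitive t.d.s. $(X,T)$ which is Banach-mean equicontinuous, and hence not Banach-mean sensitive.
   Context: A t.d.s. (topological dynamical system) is a pair $(X,T)$ where $X$ is a non-empty compact metric space with metric $d$ and $T\colon X\to X$ is continuous. $\mathbb{Z}_+$ denotes the non-negative integers and $\mathbb{N}$ the positive integers. $(X,T)$ is transitive if for all non-empty open $U,V\subset X$ there is $n\in\mathbb{N}$ with $T^nU\cap V\neq\emptyset$. $(X,T)$ is cofinitely sensitive if there is $\delta>0$ such that for every non-empty open $U\subset X$ the set $\{n\in\mathbb{Z}_+:\operatorname{diam}(T^nU)>\delta\}$ is cofinite in $\mathbb{Z}_+$. For a bounded sequence $(a_i)_{i\ge 0}$ write $\limsup_{N-M\to\infty}\frac1{N-M}\sum_{i=M}^{N-1}a_i:=\limsup_{n\to\infty}\sup_{N-M=n}\frac1n\sum_{i=M}^{N-1}a_i$ (with $M\in\mathbb{Z}_+$). A point $x\in X$ is Banach-mean equicontinuous if for every $\varepsilon>0$ there is $\delta>0$ such that for every $y\in X$ with $d(x,y)<\delta$ we have $\limsup_{N-M\to\infty}\frac1{N-M}\sum_{i=M}^{N-1}d(T^ix,T^iy)<\varepsilon$. $(X,T)$ is Banach-mean equicontinuous if all its points are. $(X,T)$ is Banach-mean sensitive if there is $\delta>0$ such that for every non-empty open $U\subset X$ there are $x,y\in U$ with $\limsup_{N-M\to\infty}\frac1{N-M}\sum_{i=M}^{N-1}d(T^ix,T^iy)>\delta$. *)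

(* Defs.v *)
From mathcomp Require Import all_boot all_order all_algebra.
From mathcomp Require Import all_classical all_reals topology.
From mathcomp Require Import ereal normedtype sequences.

Set Implicit Arguments.
Unset Strict Implicit.
Unset Printing Implicit Defensive.

Import Order.TTheory GRing.Theory Num.Theory.

Local Open Scope classical_set_scope.
Local Open Scope ring_scope.

Definition is_tds (R : realType) (X : metricType R) (T : X -> X) : Prop :=
  [/\ [set: X] !=set0, compact [set: X] & continuous T].

(* [n] ranges over the positive integers *)
Definition tds_transitive (R : realType) (X : metricType R) (T : X -> X) : Prop :=
  forall U V : set X, open U -> U !=set0 -> open V -> V !=set0 ->
  exists2 n : nat, (0 < n)%N & (iter n T @` U) `&` V !=set0.

(* The usual diameter for nonempty [A], [+oo] if [A] is unbounded; the
   diameter of the empty set is [-oo], but only nonempty sets are considered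
   below. *)
Definition diam (R : realType) (X : metricType R) (A : set X) : \bar R :=
  ereal_sup [set (mdist xy.1 xy.2)%:E | xy in A `*` A].

Definition cofinitely_sensitive (R : realType) (X : metricType R)
    (T : X -> X) : Prop :=
  exists2 delta : R, 0 < delta &
  forall U : set X, open U -> U !=set0 ->
  finite_set (~` [set n : nat | (delta%:E < diam (iter n T @` U))%E]).

(* limsup_{N - M -> oo} 1 / (N - M) \sum_(M <= i < N) a_i, with N = M + n.
   It is valued in [\bar R] so that the suprema always exist; it is finite
   when [a] is bounded. The junk value at n = 0 does not affect the limsup. *)
Definition banach_limsup (R : realType) (a : nat -> R) : \bar R :=
  limn_esup (fun n : nat =>
    ereal_sup [set (n%:R^-1 * \sum_(M <= i < (M + n)%N) a i)%:E | M in [set: nat]]).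

Definition banach_mean_dist (R : realType) (X : metricType R) (T : X -> X)
    (x y : X) : \bar R :=
  banach_limsup (fun i : nat => mdist (iter i T x) (iter i T y)).

Definition banach_mean_equicontinuous_at (R : realType) (X : metricType R)
    (T : X -> X) (x : X) : Prop :=
  forall eps : R, 0 < eps ->
  exists2 delta : R, 0 < delta &
  forall y : X, mdist x y < delta -> (banach_mean_dist T x y < eps%:E)%E.

Definition banach_mean_equicontinuous (R : realType) (X : metricType R)
    (T : X -> X) : Prop :=
  forall x : X, banach_mean_equicontinuous_at T x.

Definition banach_mean_sensitive (R : realType) (X : metricType R)
    (T : X -> X) : Prop :=
  exists2 delta : R, 0 < delta &
  forall U : set X, open U -> U !=set0 ->
  exists x y : X, [/\ U x, U y & (delta%:E < banach_mean_dist T x y)%E].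

(* Main.v *)
Require Import Defs.
From HB Require Import structures.
From mathcomp Require Import all_boot all_order all_algebra.
From mathcomp Require Import all_classical all_reals topology.
From mathcomp Require Import ereal normedtype sequences.
From mathcomp Require Import zify ring lra.

Set Implicit Arguments.
Unset Strict Implicit.
Unset Printing Implicit Defensive.

Import Order.TTheory GRing.Theory Num.Theory.

Local Open Scope classical_set_scope.
Local Open Scope ring_scope.

(** The example is a one-sided subshift in which ones are so rare that the
    Banach mean distance sees nothing, but can still be inserted freely far
    away, so that the topological dynamics is as mixing as possible.

    Let X be the set of 0-1 sequences in which every window of length n
    contains at most sqrt n ones, with the shift T and the metric 1 / (k + 1)
    where k is the first index at which two sequences differ. The defining
    conditions are closed and shift-invariant, so X is a compact subshift.

    Replacing ones by zeros preserves membership in X. Hence, if x and y are in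
    X, one may keep only their prefixes of length p and put a block of zeros
    between the two. If this gap has length at least (2 p)^2 then the result
    is again in X: a window meeting both prefixes is longer than (2 p)^2, while
    it contains at most 2 p ones ([sparse_glue]). Therefore every cylinder contains,
    for every large time, a point that reaches any other given cylinder at that
    time. This gives transitivity; steering two points of the same cylinder
    to a sequence starting with 0 and to one starting with 1 puts their images
    at distance 1 at every large time, which is cofinite sensitivity.

    On the other hand a window of length n has at most sqrt n = o(n) ones,
    uniformly in its position. The distance between two sequences is at most
    1 / (m + 1) plus the number of ones among their first m digits
    ([mdist_le_digits]); averaging over a window of length n bounds the mean
    distance by 1 / (m + 1) + 2 m / sqrt n. So the Banach mean distance of any
    two points is 0 ([banach_mean_dist_le]), which gives Banach-mean
    equicontinuity and excludes Banach-mean sensitivity at once. *)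

(** * Sequences with few ones *)

Definition ones (x : nat -> bool) (i n : nat) : nat := count x (iota i n).

(** The bound sqrt n is one choice among many: it has to grow to infinity, so
    that any finite number of ones fits into long windows, and to be o(n), so
    that ones have Banach density zero. *)
Definition is_sparse (x : nat -> bool) : Prop :=
  forall i n, (ones x i n ^ 2 <= n)%N.

Lemma ones_shift x k i n : ones (fun j => x (k + j)%N) i n = ones x (k + i) n.
Proof. by rewrite /ones iotaDl count_map. Qed.

Lemma sparse_zero : is_sparse (fun=> false).
Proof. by move=> i n; rewrite /ones count_pred0. Qed.

Lemma sparse_dirac : is_sparse (pred1 0%N).
Proof.
move=> i n; rewrite /ones count_uniq_mem ?iota_uniq// mem_iota.
by case: n => [|n]; [lia|case: (_ && _)].
Qed.

Lemma sparse_shift x k : is_sparse x -> is_sparse (fun j => x (k + j)%N).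
Proof. by move=> xs i n; rewrite ones_shift. Qed.

(** The second copy is cut off after [p] digits as well: otherwise a window
    meeting both parts could contain unboundedly many ones. *)
Definition glue (x y : nat -> bool) (p q : nat) (j : nat) : bool :=
  [|| (j < p)%N && x j | [&& (q <= j)%N, (j < q + p)%N & y (j - q)%N]].

Lemma ones_le (x y : nat -> bool) i n :
  (forall j, (i <= j < i + n)%N -> x j -> y j) ->
  (ones x i n <= ones y i n)%N.
Proof.
move=> xy; rewrite /ones (@eq_in_count _ x (predI x y)) => [|j].
  by apply: sub_count => j /andP[].
by rewrite mem_iota /= => /xy; case: (x j) => // ->.
Qed.

(** A window that meets only one of the two parts inherits the bound from [x]
    or [y]; a window that meets both is longer than the square of the
    total number of ones available. *)
Lemma sparse_glue x y p q : is_sparse x -> is_sparse y ->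
  (p + (p + p) ^ 2 <= q)%N -> is_sparse (glue x y p q).
Proof.
move=> xs ys pq i n.
have [inq|qin] := leqP (i + n) q.
  apply: leq_trans (xs i n); rewrite leq_exp2r//; apply: ones_le => j jin.
  by rewrite /glue; case: (x j); lia.
have glueD j : glue x y p q (q + j) -> y j.
  by rewrite /glue addKn; case: (y j); lia.
have [qi|iq] := leqP q i.
  apply: leq_trans (ys (i - q)%N n); rewrite leq_exp2r//.
  by rewrite -[X in ones _ X](subnKC qi) -ones_shift; apply: ones_le => j _ /glueD.
have [pi|ip] := leqP p i.
  (* the window starts inside the gap: only its part after q counts *)
  have -> : ones (glue x y p q) i n = ones (glue x y p q) q (i + n - q).
    rewrite [in LHS](_ : n = (q - i) + (i + n - q))%N; last lia.
    rewrite /ones iotaD count_cat subnKC 1?ltnW// -[RHS]add0n; congr addn.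
    apply/eqP; rewrite -leqn0 leqNgt -has_count; apply/hasPn => j.
    by rewrite mem_iota /glue; lia.
  rewrite -[X in ones _ X]addn0 -ones_shift.
  apply: (@leq_trans (i + n - q)); last by lia.
  apply: leq_trans (ys 0%N (i + n - q)%N); rewrite leq_exp2r//.
  by apply: ones_le => j _ /glueD.
(* the window covers the gap, so that n >= (p + p) ^ 2 *)
suff : (ones (glue x y p q) i n <= p + p)%N by nia.
rewrite -[X in (_ <= X + _)%N](size_iota 0) -[X in (_ <= _ + X)%N](size_iota q).
rewrite -size_cat /ones -size_filter; apply: uniq_leq_size.
  by rewrite filter_uniq ?iota_uniq.
by move=> j; rewrite mem_filter mem_cat !mem_iota /glue; lia.
Qed.

(** Ones have Banach density zero: [s ^ 2 <= n] implies [s <= c * n] once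
    [n >= c ^- 2], whatever the position of the window and the sequence. *)
Lemma ones_negligible (R : realType) (c : R) : 0 < c ->
  exists N, forall x n i, is_sparse x -> (N <= n)%N -> (ones x i n)%:R <= c * n%:R.
Proof.
move=> c0; exists (Num.truncn (c ^- 2)).+1 => x n i xs Nn.
have := xs i n; set s := ones x i n => sn.
rewrite -(@ler_pXn2r _ 2)// ?nnegrE ?mulr_ge0 ?(ltW c0)// -natrX.
apply: (@le_trans _ _ n%:R); first by rewrite ler_nat.
rewrite exprMn [n%:R ^+ 2]expr2 mulrA ler_peMl// -ler_pdivrMl ?exprn_gt0//.
by rewrite mulr1 (le_trans (ltW (truncnS_gt _)))// ler_nat.
Qed.

(** * The metric space of sparse sequences *)

Record sparse_seq := SparseSeq {
  digit :> nat -> bool;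
  sparseP : is_sparse digit }.

HB.instance Definition _ := gen_eqMixin sparse_seq.
HB.instance Definition _ := gen_choiceMixin sparse_seq.

Lemma sparse_seq_ext (x y : sparse_seq) : (forall i, x i = y i) -> x = y.
Proof.
case: x => x xs; case: y => y ys /= /funext xy.
by subst y; congr SparseSeq; exact: Prop_irrelevance.
Qed.

(** The alias carries the field in which distances take their values. *)
Definition sparse_space (R : realType) : Type := sparse_seq.

Section sparse_shift.
Variable R : realType.
Implicit Types x y z : sparse_space R.

HB.instance Definition _ := Choice.on (sparse_space R).

Definition sdist (x y : sparse_space R) : R :=
  if pselect (exists i, x i != y i) is left xy then (ex_minn xy).+1%:R^-1 else 0.

Lemma sdist_ge0 x y : 0 <= sdist x y.
Proof. by rewrite /sdist; case: pselect. Qed.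

Lemma sdist_ge x y i : x i != y i -> i.+1%:R^-1 <= sdist x y.
Proof.
move=> xyi; rewrite /sdist; case: pselect => [xy|[]]; last by exists i.
case: ex_minnP => k _ /(_ _ xyi) ki.
by rewrite lef_pV2 ?posrE ?ltr0n// ler_nat.
Qed.

Lemma sdist_le x y n :
  (forall i, (i < n)%N -> x i = y i) -> sdist x y <= n.+1%:R^-1.
Proof.
move=> xyn; rewrite /sdist; case: pselect => // xy.
case: ex_minnP => k xyk _; rewrite lef_pV2 ?posrE ?ltr0n// ler_nat ltnS.
by rewrite leqNgt; apply/negP => /xyn/eqP; apply/negP.
Qed.

Lemma sdist_lt x y n i : sdist x y < n.+1%:R^-1 -> (i <= n)%N -> x i = y i.
Proof.
move=> xyn ni; apply/eqP/negPn/negP => /sdist_ge xyi.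
have := le_lt_trans xyi xyn.
by rewrite ltf_pV2 ?posrE ?ltr0n// ltr_nat ltnS ltnNge ni.
Qed.

Lemma sdistxx x : sdist x x = 0.
Proof. by rewrite /sdist; case: pselect => // xx; have [i] := xx; rewrite eqxx. Qed.

Lemma sdist_eq0 x y : sdist x y = 0 -> x = y.
Proof.
move=> xy; apply: sparse_seq_ext => i; apply: (@sdist_lt x y i) => //.
by rewrite xy invr_gt0 ltr0n.
Qed.

Lemma sdist_sym x y : sdist x y = sdist y x.
Proof.
rewrite /sdist; case: pselect => [xy|xy]; case: pselect => [yx|yx] //.
- by congr (_.+1%:R^-1); apply: eq_ex_minn => i; rewrite eq_sym.
- by have [j xyj] := xy; case: yx; exists j; rewrite eq_sym.
- by have [j yxj] := yx; case: xy; exists j; rewrite eq_sym.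
Qed.

Lemma sdist_triangle y x z : sdist x z <= sdist x y + sdist y z.
Proof.
rewrite {1}/sdist; case: pselect => [xz|_]; last by rewrite addr_ge0 ?sdist_ge0.
case: ex_minnP => k xzk _; have [xyk|/sdist_ge xyk] := eqVneq (x k) (y k).
  by rewrite ler_wpDl ?sdist_ge0//; apply: sdist_ge; rewrite -xyk.
by rewrite ler_wpDr ?sdist_ge0.
Qed.

HB.instance Definition _ := isMetric.Build R (sparse_space R)
  sdistxx sdist_eq0 sdist_sym sdist_triangle.

Lemma mdistE x y : mdist x y = sdist x y.
Proof. by []. Qed.

(** Open sets enter the dynamics only through cylinders, so that continuity,
    compactness and transitivity become statements about prefixes. *)
Lemma nbhs_cylinder x (U : set (sparse_space R)) :
  nbhs x U <-> exists p, forall y, (forall j, (j < p)%N -> x j = y j) -> U y.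
Proof.
rewrite -nbhs_ballE; split=> [[e /= e0 xU]|[p xU]].
  exists (Num.truncn e^-1).+1 => y xy; apply: xU; rewrite ballEmdist/= mdistE.
  rewrite (le_lt_trans (sdist_le xy))// invf_plt ?posrE ?ltr0n//.
  by rewrite (lt_trans (truncnS_gt _))// ltr_nat.
exists p.+1%:R^-1; first by rewrite /= invr_gt0 ltr0n.
move=> y; rewrite ballEmdist/= mdistE => xy; apply: xU => j jp.
by apply: (sdist_lt xy); exact: ltnW.
Qed.

(** * Dynamics of the shift *)

Definition shift x : sparse_space R := SparseSeq (sparse_shift 1 (sparseP x)).

Lemma iter_shiftE n x i : iter n shift x i = x (n + i)%N.
Proof. by elim: n i => //= n IH i; rewrite IH add1n addnS. Qed.

Lemma shift_continuous : continuous shift.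
Proof.
move=> x U /nbhs_cylinder[p xU]; apply/nbhs_cylinder; exists p.+1 => y xy.
by apply: xU => j jp; apply: xy.
Qed.

(** An ultrafilter decides every digit, hence every prefix; its limit is the
    sequence of these decisions, which is sparse because each window of it
    occurs in some sparse sequence. *)
Lemma sparse_space_compact : compact [set: sparse_space R].
Proof.
rewrite compact_ultra => F FU _.
pose x j : bool := `[< F [set y : sparse_space R | y j] >].
have Fx j : F [set y : sparse_space R | x j = y j].
  rewrite /x; case: asboolP => [|nFj]; first by apply: filterS => y /= ->.
  have [//|] := in_ultra_setVsetC [set y : sparse_space R | y j] FU.
  by apply: filterS => y nyj; apply/esym/negbTE/negP.
have Fxn n : F [set y : sparse_space R | forall j, (j < n)%N -> x j = y j].
  elim: n => [|n IH]; first by apply: filterS filterT => y _ j.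
  apply: filterS (filterI IH (Fx n)) => y [yx yn] j.
  by rewrite ltnS leq_eqVlt => /predU1P[->//|]; exact: yx.
have xs : is_sparse x.
  move=> i n; have [y xy] := filter_ex (Fxn (i + n)%N).
  apply: leq_trans (sparseP y i n); rewrite leq_exp2r//.
  by apply: ones_le => j /andP[_ jin]; rewrite xy.
exists (SparseSeq xs : sparse_space R); split=> // U /nbhs_cylinder[p xU].
exact: filterS (Fxn p).
Qed.

Lemma exists_glue x y p q : (p + (p + p) ^ 2 <= q)%N ->
  exists z, forall j, (j < p)%N -> z j = x j /\ z (q + j)%N = y j.
Proof.
move=> pq; exists (SparseSeq (sparse_glue (sparseP x) (sparseP y) pq)) => j jp /=.
rewrite /glue addKn ltn_add2l jp leq_addr; split.
  by case: (x j); lia.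
by case: (y j); case: (x _); lia.
Qed.

Definition szero : sparse_space R := SparseSeq sparse_zero.
Definition sdirac : sparse_space R := SparseSeq sparse_dirac.

Lemma sparse_space_tds : is_tds shift.
Proof.
split; [by exists szero|exact: sparse_space_compact|exact: shift_continuous].
Qed.

Lemma shift_transitive : tds_transitive shift.
Proof.
move=> U V oU [x Ux] oV [y Vy].
have /nbhs_cylinder[p xU] := open_nbhs_nbhs (conj oU Ux).
have /nbhs_cylinder[r yV] := open_nbhs_nbhs (conj oV Vy).
pose m := (p + r)%N.
have [z zE] := exists_glue x y (leqnSn (m + (m + m) ^ 2)).
exists (m + (m + m) ^ 2).+1 => //; exists (iter (m + (m + m) ^ 2).+1 shift z).
split.
  by exists z => //; apply: xU => j jp; apply/esym/(zE _ _).1; lia.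
by apply: yV => j jr; rewrite iter_shiftE; apply/esym/(zE _ _).2; lia.
Qed.

(** A prefix taken from the open set may be continued, at every large time, by
    a zero or by a one: the two continuations are then at distance 1. *)
Lemma shift_cofinitely_sensitive : cofinitely_sensitive shift.
Proof.
exists (2^-1); first by rewrite invr_gt0.
move=> U oU [x Ux].
have /nbhs_cylinder[p xU] := open_nbhs_nbhs (conj oU Ux).
(* the prefix must be nonempty for glue to copy a digit of its second argument *)
pose m := p.+1; apply: (sub_finite_set _ (finite_II (m + (m + m) ^ 2))) => n /=.
apply: contra_notP => /negP; rewrite -leqNgt => mn.
have [z0 z0E] := exists_glue x szero mn.
have [z1 z1E] := exists_glue x sdirac mn.
have Uz (z : sparse_space R) : (forall j, (j < m)%N -> z j = x j) -> U z.
  by move=> zx; apply: xU => j jp; rewrite zx// ltnW.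
apply: (@lt_le_trans _ _ 1%:E); first by rewrite lte_fin invf_lt1 ?ltr1n.
apply: (@le_trans _ _ (mdist (iter n shift z0) (iter n shift z1))%:E).
  rewrite lee_fin -[leLHS]invr1 mdistE; apply: (@sdist_ge _ _ 0).
  by rewrite !iter_shiftE (z0E _ _).2// (z1E _ _).2.
apply: ereal_sup_ubound; exists (iter n shift z0, iter n shift z1) => //.
split; [exists z0|exists z1] => //; apply: Uz => j jm.
  exact: (z0E _ jm).1.
exact: (z1E _ jm).1.
Qed.

(** * Banach means of distances *)

(** Two sequences whose first [m] digits are all zero are [1 / (m + 1)]-close;
    otherwise one of the digits in the sum already dominates the diameter 1 of
    the space. *)
Lemma mdist_le_digits x y m :
  mdist x y <= m.+1%:R^-1 + \sum_(j < m) ((x j)%:R + (y j)%:R).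
Proof.
rewrite mdistE; have [/forallP xy|] := boolP [forall j : 'I_m, x j == y j].
  rewrite ler_wpDr ?sumr_ge0//.
  by apply: sdist_le => j jm; exact/eqP/(xy (Ordinal jm)).
rewrite negb_forall => /existsP[j xyj]; rewrite ler_wpDl//.
rewrite (@le_trans _ _ 1)//.
  by rewrite -[leRHS]invr1; exact: (@sdist_le _ _ 0).
rewrite (bigD1 j)//= ler_wpDr ?sumr_ge0//.
by move: xyj; case: (x j); case: (y j) => //= _; rewrite ?addr0 ?add0r.
Qed.

Lemma natr_ones (z : nat -> bool) i n :
  (ones z i n)%:R = \sum_(i <= j < i + n) (z j)%:R :> R.
Proof.
rewrite /ones -sum1_count natr_sum big_mkcond /index_iota addKn.
by apply: eq_bigr => j _; case: (z j).
Qed.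

(** Exchanging the sums turns the digits at offset [j] along the orbit segment
    into the ones of a window of the same length, translated by [j]. *)
Lemma sum_mdist_le x y m M n :
  \sum_(M <= i < M + n) mdist (iter i shift x) (iter i shift y) <=
  n%:R / m.+1%:R + \sum_(j < m) ((ones x (j + M) n)%:R + (ones y (j + M) n)%:R).
Proof.
apply: (le_trans (ler_sum _ (fun i _ => mdist_le_digits _ _ m))).
rewrite big_split /= sumr_const_nat addKn mulr_natl lerD2l.
rewrite exchange_big /= ler_sum// => j _.
under eq_bigr do rewrite !iter_shiftE.
rewrite big_split /= -!(ones_shift _ j) !natr_ones.
by rewrite lerD// ler_sum// => i _; rewrite addnC.
Qed.

End sparse_shift.

Lemma banach_limsup_le (R : realType) (a : nat -> R) (e : R) :
  (exists N, forall n M, (N <= n)%N -> n%:R^-1 * \sum_(M <= i < M + n) a i <= e) ->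
  (banach_limsup a <= e%:E)%E.
Proof.
move=> [N aN].
apply: (@le_trans _ _ (ereal_sup ((fun n => ereal_sup
    [set (n%:R^-1 * \sum_(M <= i < M + n) a i)%:E | M in [set: nat]]) @`
  [set n | (N <= n)%N]))).
  by apply: ereal_inf_lbound; exists [set n | (N <= n)%N] => //; exact: nbhs_infty_ge.
apply: ge_ereal_sup => _ [n /= Nn <-]; apply: ge_ereal_sup => _ [M _ <-].
by rewrite lee_fin; exact: aN.
Qed.

Lemma banach_mean_dist_le (R : realType) (x y : sparse_space R) (e : R) :
  0 < e -> (banach_mean_dist (@shift R) x y <= e%:E)%E.
Proof.
move=> e0; apply: banach_limsup_le.
(* m makes the prefix term at most e / 2; the slope e / (4 (m + 1)) for the
   ones makes the 2 m windows of x and y contribute at most e / 2 in total *)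
pose m := Num.truncn (e / 2)^-1.
have m0 : (0 : R) < m.+1%:R by rewrite ltr0n.
have [N zN] : exists N, forall z n i, is_sparse z -> (N <= n)%N ->
    (ones z i n)%:R <= e / 4 / m.+1%:R * n%:R.
  by apply: ones_negligible; rewrite !divr_gt0.
exists N.+1 => n M Nn; have n0 : (0 : R) < n%:R by rewrite ltr0n; lia.
rewrite ler_pdivrMl//; apply: (le_trans (sum_mdist_le x y m M n)).
apply: (@le_trans _ _ (n%:R * (e / 2) + n%:R * (e / 2))); last by lra.
rewrite lerD//.
  by rewrite ler_pM2l// invf_ple ?posrE ?divr_gt0// ltW// truncnS_gt.
have zn (z : sparse_space R) i : (ones z i n)%:R <= e / 4 / m.+1%:R * n%:R.
  by apply: zN; [exact: sparseP|exact: ltnW].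
apply: (@le_trans _ _ (\sum_(j < m) (e / 2 * n%:R / m.+1%:R))).
  apply: ler_sum => j _; rewrite (le_trans (lerD (zn x _) (zn y _)))//.
  by rewrite le_eqVlt; apply/orP; left; apply/eqP; field; lra.
rewrite sumr_const card_ord -(mulr_natr _ m) -mulrA [leRHS]mulrC ler_piMr//.
  by rewrite mulr_ge0 ?divr_ge0 ?(ltW e0).
by rewrite ler_pdivrMl// mulr1 ler_nat.
Qed.

Theorem theorem1p3 (R : realType) :
  exists (X : metricType R) (T : X -> X),
    [/\ is_tds T,
        tds_transitive T,
        cofinitely_sensitive T,
        banach_mean_equicontinuous T
      & ~ banach_mean_sensitive T].
Proof.
exists (sparse_space R), (@shift R); split.
- exact: sparse_space_tds.
- exact: shift_transitive.
- exact: shift_cofinitely_sensitive.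
- move=> x e e0; exists 1 => // y _.
  apply: le_lt_trans (banach_mean_dist_le x y (divr_gt0 e0 (@ltr0n R 2))) _.
  by rewrite lte_fin ltr_pdivrMr// ltr_pMr// ltr1n.
- move=> [d d0 /(_ setT openT)] [|x [y [_ _]]]; first by exists (szero R).
  by rewrite ltNge banach_mean_dist_le.
Qed.
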